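(* Let $\mathbb{B}\subset\mathbb{N}$ be such that the limit $\lim_{n\to\infty}\frac{|\mathbb{B}\cap\mathbb{N}_n|}{n}$ exists and is $>0$, and such that for all $n\in\mathbb{N}$ $$\#\{\text{axes }\mathbb{L}_{[x],[y]}\text{ of }\mathcal{C}(n)\ :\ x\in\mathbb{N}\setminus\mathbb{B},\ y\in\mathbb{B}\}\leq\nu(n,\mathbb{B}).$$ Put $\mathcal{G}_{\mathbb{B}}(n)=\nu(n,\mathbb{B})$. If $\mathcal{G}_{\mathbb{B}}(n)>0$ for all sufficiently large $n$, then $$\limsup_{n\to\infty}\mathcal{G}_{\mathbb{B}}(n)=\infty.$$
   Context: $\mathbb{N}=\{1,2,\dots\}$ and $\mathbb{N}_n=\{1,\dots,n\}$. For $n\in\mathbb{N}$ and $\mathbb{M}\subseteq\mathbb{N}$, the circle of partition is $\mathcal{C}(n,\mathbb{M})=\{[x]: x,y\in\mathbb{M},\ x+y=n\}$, and $\mathcal{C}(n)=\mathcal{C}(n,\mathbb{N})$. An axis $\mathbb{L}_{[x],[y]}$ of $\mathcal{C}(n,\mathbb{M})$ is an unordered pair of distinct points $[x],[y]\in\mathcal{C}(n,\mathbb{M})$ with $x+y=n$ (the center $[n/2]$, if present, is not an axis point). $\nu(n,\mathbb{M})$ is the number of axes of $\mathcal{C}(n,\mathbb{M})$, i.e. the number of unordered pairs $\{x,y\}\subseteq\mathbb{M}$ with $x\neq y$, $x+y=n$. An axis of $\mathcal{C}(n)$ counted on the left-hand side of the inequality is one with exactly one of its two weights in $\mathbb{B}$.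 *)

(* Defs.v *)
From HB Require Import structures.
From mathcomp Require Import all_boot all_order all_algebra finmap.
From mathcomp Require Import all_classical all_reals all_analysis.

Set Implicit Arguments.
Unset Strict Implicit.
Unset Printing Implicit Defensive.

Import Order.TTheory GRing.Theory Num.Theory.

Local Open Scope classical_set_scope.
Local Open Scope nat_scope.

(* The positive integers {1, 2, ...}. *)
Definition Npos : set nat := [set n | 0 < n].

Definition upto (n : nat) : set nat := [set k | 1 <= k <= n].

(* The circle of partition C(n, M); the point [x] is encoded by its weight x. *)
Definition circle (n : nat) (M : set nat) : set nat :=
  [set x | M x /\ exists2 y, M y & x + y = n].

(* An axis is an unordered pair of points, encoded as a finite set. *)
Definition axes (n : nat) (M : set nat) : set {fset nat} :=
  [set L | exists x y, [/\ circle n M x, circle n M y, x != y, x + y = n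
                         & L = [fset x; y]%fset]].

(* Cardinality of a finite set. It is 0 by convention on infinite sets, but it
   is only applied below to sets that are finite: see the three lemmas on
   finiteness. *)
Definition num_elts (T : choiceType) (A : set T) : nat := #|` fset_set A|%fset.

Definition num_axes (n : nat) (M : set nat) : nat := num_elts (axes n M).

(* The axes of C(n) having exactly one of their two weights in B. *)
Definition mixed_axes (n : nat) (B : set nat) : set {fset nat} :=
  [set L | axes n Npos L /\
           exists x y, [/\ (Npos `\` B) x, B y & L = [fset x; y]%fset]].

Definition density_seq (R : realType) (B : set nat) : nat -> R :=
  fun n => ((num_elts (B `&` upto n))%:R / n%:R)%R.

Lemma finite_axes n M : finite_set (axes n M).
Proof.
have fN : finite_set [set` fpowerset (fset_set `I_n.+1)] by exact: finite_fset.
apply: sub_finite_set fN => L [x [y [_ _ _ xyn ->]]] /=.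
rewrite fpowersetE; apply/fsubsetP => z.
rewrite in_fset2 in_fset_set ?inE /=; last exact: finite_II.
by move=> /orP[]/eqP->; rewrite ltnS -xyn ?leq_addr ?leq_addl.
Qed.

Lemma finite_mixed_axes n B : finite_set (mixed_axes n B).
Proof. by apply: sub_finite_set (finite_axes n Npos) => L []. Qed.

Lemma finite_upto B n : finite_set (B `&` upto n).
Proof.
by apply: sub_finite_set (finite_II n.+1) => k [_ /andP[_ kn]].
Qed.

(* Main.v *)
(** Every x in B with 1 <= x <= n, other than n and n/2, lies on the axis
    {x, n - x}, which is either an axis of C(n, B) or a mixed axis. As an axis
    has two points, #(B `&` upto n) <= 2 + 2 (#mixed + nu(n, B)) <= 2 + 4 nu(n, B).
    Positive density makes the left-hand side tend to infinity, so nu(n, B)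
    itself tends to infinity. *)
Require Import Defs.
From HB Require Import structures.
From mathcomp Require Import all_boot all_order all_algebra finmap.
From mathcomp Require Import all_classical all_reals all_analysis.
From mathcomp Require Import zify lra.

Set Implicit Arguments.
Unset Strict Implicit.
Unset Printing Implicit Defensive.

Import Order.TTheory GRing.Theory Num.Theory.
Import numFieldNormedType.Exports.

Local Open Scope classical_set_scope.
Local Open Scope ring_scope.

Lemma leq_card_bigfcup (T : choiceType) (s : seq {fset T}) (k : nat) :
  (forall L, L \in s -> (#|` L| <= k)%N) ->
  (#|` (\bigcup_(L <- s) L)%fset| <= size s * k)%N.
Proof.
elim: s => [|L s IHs] Ls; first by rewrite big_nil cardfs0.
rewrite big_cons mulSn (leq_trans (leq_card_fsetU _ _))// leq_add//.
  by rewrite Ls ?mem_head.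
by apply: IHs => L' L's; rewrite Ls// inE L's orbT.
Qed.

Lemma card_axis n M L : axes n M L -> (#|` L| <= 2)%N.
Proof. by move=> [x [y [_ _ _ _ ->]]]; rewrite cardfs2; case: (x != y). Qed.

(** The two exclusions make the partner [n - x] positive and distinct from [x]; whether it lies in
    [B] decides the kind of axis. *)
Lemma mem_axis n (B : set nat) x : B `<=` Npos -> B x -> upto n x ->
  x != n -> x != n./2 -> (axes n B `|` mixed_axes n B) [fset x; n - x]%fset%N.
Proof.
move=> BN Bx /andP[x1 xn] xNn xNn2.
have xnx : (x + (n - x) = n)%N by lia.
have nxx : (n - x + x = n)%N by lia.
have nx0 : Npos (n - x)%N by rewrite /Npos/=; lia.
have xNnx : x != (n - x)%N by lia.
have [Bnx|NBnx] := pselect (B (n - x)%N); [left|right].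
  by exists x, (n - x)%N; split=> //; split=> //; [exists (n - x)%N|exists x].
(* [mixed_axes] lists the weight outside [B] first, hence the swapped witnesses. *)
split; last by exists (n - x)%N, x; split=> //; rewrite fsetUC.
exists x, (n - x)%N; split=> //; split=> //; first by exists (n - x)%N.
by exists x.
Qed.

Lemma card_upto_le n (B : set nat) : B `<=` Npos ->
  (num_elts (B `&` upto n) <=
   2 + (num_axes n B + num_elts (mixed_axes n B)) * 2)%N.
Proof.
move=> BN; rewrite /num_axes /num_elts.
set A := fset_set (axes n B); set M := fset_set (mixed_axes n B).
(* Concatenating the two lists makes the size of the cover the sum of the two counts, with no
   disjointness argument. *)
have inAM L : (L \in (A ++ M : seq _)) = (L \in axes n B `|` mixed_axes n B).
  rewrite mem_cat in_setU !in_fset_set//.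
    exact: finite_mixed_axes.
  exact: finite_axes.
have AM2 L : L \in (A ++ M : seq _) -> (#|` L| <= 2)%N.
  by rewrite inAM inE => -[|[+ _]]; exact: card_axis.
have /fsubset_leq_card : (fset_set (B `&` upto n) `<=`
    [fset n; n./2] `|` \bigcup_(L <- A ++ M) L)%fset.
  apply/fsubsetP => x; rewrite in_fset_set; last exact: finite_upto.
  rewrite inE => -[Bx xn]; rewrite in_fsetU in_fset2.
  have [//|xNn] := eqVneq x n; have [//|xNn2] := eqVneq x n./2; apply/bigfcupP.
  exists [fset x; n - x]%fset%N; last by rewrite in_fset2 eqxx.
  by rewrite andbT inAM inE; exact: mem_axis.
move=> /leq_trans; apply.
rewrite (leq_trans (leq_card_fsetU _ _))// leq_add//.
  by rewrite cardfs2; case: (n != n./2).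
by rewrite -size_cat leq_card_bigfcup.
Qed.

(** Eventually the ratio exceeds half its limit [l], so the count is at least [(l / 2) * n], which
    is unbounded. *)
Lemma cvgn_pos_density (R : realType) (B : set nat) :
  cvgn (density_seq R B) -> 0 < limn (density_seq R B) ->
  (num_elts (B `&` upto n))%:R @[n --> \oo] --> (+oo : set_system R).
Proof.
set l := limn _ => cB l0; apply/cvgryPge => A.
near=> n.
have n0 : 0 < n%:R :> R by near: n; exact: nbhs_infty_gtr.
have ln : l / 2 < density_seq R B n.
  near: n; apply: (cvgr_gt l) => //.
  by rewrite ltr_pdivrMr// ltr_pMr// ltr1n.
have An : A / (l / 2) <= n%:R by near: n; exact: nbhs_infty_ger.
rewrite ler_pdivrMr ?divr_gt0// in An.
by rewrite (le_trans An)// mulrC -ler_pdivlMr// ltW.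
Unshelve. all: by end_near. Qed.

Theorem theorem4p6 (R : realType) (B : set nat)
  (B_sub : B `<=` Npos)
  (B_density_cvg : cvgn (density_seq R B))
  (B_density_gt0 : 0 < limn (density_seq R B))
  (B_axes : forall n : nat, Npos n -> (num_elts (mixed_axes n B) <= num_axes n B)%N)
  (B_nu_gt0 : \forall n \near \oo, (0 < num_axes n B)%N) :
  limn_esup (fun n : nat => ((num_axes n B)%:R : R)%:E) = +oo%E.
Proof.
(* The limsup is obtained from full divergence to [+oo], checked on real thresholds [A]. *)
apply: (cvg_limn_einf_sup _).2; apply/cvgeryP/cvgryPge => A; near=> n.
have n0 : Npos n by near: n; exact: nbhs_infty_gt.
(* This threshold matches the upper bound [2 + 4 * num_axes n B], so that comparing the two leaves
   [A <= num_axes n B]. *)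
have Bn : 2 + 4 * A <= (num_elts (B `&` upto n))%:R :> R.
  (* Generalizing the threshold turns the goal into the criterion for divergence. *)
  near: n; move: (2 + 4 * A).
  exact/cvgryPge/cvgn_pos_density.
have : (num_elts (B `&` upto n) <= 2 + 4 * num_axes n B)%N.
  have := card_upto_le n B_sub; have := B_axes n n0; lia.
rewrite -(ler_nat R) natrD natrM; lra.
Unshelve. all: by end_near. Qed.
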